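(* Let $K$ be a field of characteristic $\neq 2,3$ and let $\gamma\in K$ with $\gamma\neq 0,\pm 1,\pm\frac12$. Then every commutative (not necessarily associative) $K$-algebra satisfying the identity $L_x^3+\gamma L_{x^3}=0$ is locally nilpotent. More precisely, for every $k\ge 1$, every commutative $K$-algebra generated by $k$ elements and satisfying the identity $L_x^3+\gamma L_{x^3}=0$ is nilpotent of index at most $2^{4n\dim[n,k]+2(n-2)}$, where $n$ is the index of nilpotency of the free commutative $K$-algebra on $k$ generators satisfying the identity $x^3=0$.
   Context: Algebras are nonassociative and not assumed unital. For $x$ in a commutative algebra $A$, $L_x:A\to A$ denotes the multiplication operator $L_x(a)=xa$, and $x^3=x(xx)$. The identity $L_x^3+\gamma L_{x^3}=0$ means $x(x(xa))+\gamma\,x^3a=0$ for all $x,a\in A$. An algebra is nilpotent of index at most $N$ if every product of $N$ or more of its elements, with any arrangement of parentheses, is zero; the index of nilpotency is the least such $N$. An algebra is locally nilpotent if each of its finitely generated subalgebras is nilpotent. The free commutative $K$-algebra on $k$ generators satisfying $x^3=0$ is the quotient of the (absolutely) free commutative nonassociative $K$-algebra (without unit) on $k$ generators by the ideal generated by all cubes $x^3$ of its elements (this algebra is nilpotent). For positive integers $n,k$, $\dim[n,k]$ denotes the number of distinct commutative nonassociative monomials of degree less than $n$ in $k$ generators (each generator having degree $1$), i.e. the dimension of the subspace of the (absolutely) free commutative nonassociative algebra on $k$ generators spanned by the monomials of degree less than $n$. *)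

(* Defs.v *)
From HB Require Import structures.
From mathcomp Require Import all_boot all_order all_algebra finmap.
From mathcomp Require Import boolp classical_sets functions cardinality.
From mathcomp Require Import monalg.

Set Implicit Arguments.
Unset Strict Implicit.
Unset Printing Implicit Defensive.

Import GRing.Theory.

Local Open Scope classical_set_scope.
Local Open Scope quotient_scope.
Local Open Scope ring_scope.

HB.mixin Record Lmodule_isComNAAlg (K : fieldType) A of GRing.Lmodule K A := {
  namul : A -> A -> A;
  namulC : commutative namul;
  namulDl : left_distributive namul +%R;
  namulZl : forall (c : K) (x y : A), namul (c *: x) y = c *: namul x y
}.

(* Commutative K-algebras, neither associative nor unital in general. *)
#[short(type="comNAAlgType")]
HB.structure Definition ComNAAlg (K : fieldType) :=
  {A of Lmodule_isComNAAlg K A & GRing.Lmodule K A}.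

Notation "x ** y" := (namul x y) (at level 40, left associativity) : ring_scope.

Inductive btree (T : Type) : Type :=
| Leaf of T
| Node of btree T & btree T.

Fixpoint leaves T (t : btree T) : nat :=
  match t with Leaf _ => 1%N | Node l r => (leaves l + leaves r)%N end.

Fixpoint leaves_in T (B : set T) (t : btree T) : Prop :=
  match t with Leaf x => B x | Node l r => leaves_in B l /\ leaves_in B r end.

Section Algebra.
Variables (K : fieldType) (A : comNAAlgType K).
Implicit Types (x y : A) (B S : set A).

Definition Lop x : A -> A := fun a => x ** a.

Definition cube x : A := x ** (x ** x).

Fixpoint tprod (t : btree A) : A :=
  match t with Leaf x => x | Node l r => tprod l ** tprod r end.

Definition nilpotent_upto B (N : nat) : Prop :=
  forall t : btree A, leaves_in B t -> (N <= leaves t)%N -> tprod t = 0.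

Definition nilpotent_set B : Prop := exists N, nilpotent_upto B N.

Definition nilpotency_index B (n : nat) : Prop :=
  nilpotent_upto B n /\ forall m, nilpotent_upto B m -> (n <= m)%N.

Definition is_subalgebra B : Prop :=
  [/\ B 0, forall (c : K) x y, B x -> B y -> B (c *: x + y)
    & forall x y, B x -> B y -> B (x ** y)].

(* By commutativity every ideal is two-sided. *)
Definition is_ideal B : Prop :=
  [/\ B 0, forall (c : K) x y, B x -> B y -> B (c *: x + y)
    & forall x y, B y -> B (x ** y)].

Definition subalgebra_gen S : set A := smallest is_subalgebra S.

Definition ideal_gen S : set A := smallest is_ideal S.

Definition locally_nilpotent : Prop :=
  forall S, finite_set S -> nilpotent_set (subalgebra_gen S).

Definition generated_by (k : nat) : Prop :=
  exists g : 'I_k -> A, subalgebra_gen (range g) = setT.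

Definition Lcube_identity (gamma : K) : Prop :=
  forall x a, Lop x (Lop x (Lop x a)) + gamma *: Lop (cube x) a = 0.

Lemma namulDr : right_distributive (@namul K A) +%R.
Proof. by move=> x y z; rewrite !(namulC x) namulDl. Qed.

Lemma namulZr (c : K) x y : x ** (c *: y) = c *: (x ** y).
Proof. by rewrite !(namulC x) namulZl. Qed.

Lemma ideal_gen_ideal S : is_ideal (ideal_gen S).
Proof.
split=> [B [[]]//|c x y Ix Iy B BS|x y Iy B BS]; have [[_ BD BM] _] := BS.
  exact: BD (Ix B BS) (Iy B BS).
exact: BM (Iy B BS).
Qed.

End Algebra.

Section Quotient.
Variables (K : fieldType) (A : comNAAlgType K) (S : set A).
Implicit Types x y z : A.

Definition ideal_eqb : rel A := fun x y => `[< ideal_gen S (x - y) >].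

Let I0 : ideal_gen S 0. Proof. by have [] := ideal_gen_ideal S. Qed.

Let ID x y : ideal_gen S x -> ideal_gen S y -> ideal_gen S (x + y).
Proof.
by have [_ + _ Ix Iy] := ideal_gen_ideal S => /(_ 1 x y Ix Iy); rewrite scale1r.
Qed.

Let IZ (c : K) x : ideal_gen S x -> ideal_gen S (c *: x).
Proof.
by have [_ + _ Ix] := ideal_gen_ideal S => /(_ c x 0 Ix I0); rewrite addr0.
Qed.

Let IM x y : ideal_gen S y -> ideal_gen S (x ** y).
Proof. by have [_ _] := ideal_gen_ideal S; apply. Qed.

Lemma ideal_eqb_refl : reflexive ideal_eqb.
Proof. by move=> x; apply/asboolP; rewrite subrr. Qed.

Lemma ideal_eqb_sym : symmetric ideal_eqb.
Proof.
move=> x y; apply/asboolP/asboolP => /(IZ (-1));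
  by rewrite scaleN1r opprB.
Qed.

Lemma ideal_eqb_trans : transitive ideal_eqb.
Proof.
move=> y x z /asboolP xy /asboolP yz; apply/asboolP.
by have := ID xy yz; rewrite addrA subrK.
Qed.

Canonical ideal_equiv :=
  EquivRel ideal_eqb ideal_eqb_refl ideal_eqb_sym ideal_eqb_trans.

(* A modulo the ideal generated by S. *)
Definition quotAlg : Type := {eq_quot ideal_equiv}.

HB.instance Definition _ := Choice.on quotAlg.
HB.instance Definition _ := EqQuotient.on quotAlg.

Lemma quotAlg_eqP x y :
  reflect (ideal_gen S (x - y)) (\pi_quotAlg x == \pi_quotAlg y).
Proof. by rewrite eqquotE; apply: asboolP. Qed.

Lemma quotAlg_piP x y :
  ideal_gen S (x - y) -> \pi_quotAlg x = \pi_quotAlg y.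
Proof. by move=> h; apply/eqP/quotAlg_eqP. Qed.

Lemma quotAlg_repr x : ideal_gen S (x - repr (\pi_quotAlg x)).
Proof. by apply/quotAlg_eqP; rewrite reprK. Qed.

Definition qzero : quotAlg := \pi_quotAlg 0.
Definition qopp (u : quotAlg) : quotAlg := \pi_quotAlg (- repr u).
Definition qadd (u v : quotAlg) : quotAlg := \pi_quotAlg (repr u + repr v).
Definition qscale (c : K) (u : quotAlg) : quotAlg := \pi_quotAlg (c *: repr u).
Definition qmul (u v : quotAlg) : quotAlg := \pi_quotAlg (repr u ** repr v).

Lemma qoppE x : qopp (\pi_quotAlg x) = \pi_quotAlg (- x).
Proof.
apply/esym/quotAlg_piP; rewrite -opprD -[- (_ - _)]scaleN1r.
apply: IZ; exact: quotAlg_repr.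
Qed.

Lemma qaddE x y : qadd (\pi_quotAlg x) (\pi_quotAlg y) = \pi_quotAlg (x + y).
Proof.
by apply/esym/quotAlg_piP; rewrite opprD addrACA; apply: ID; apply: quotAlg_repr.
Qed.

Lemma qscaleE (c : K) x : qscale c (\pi_quotAlg x) = \pi_quotAlg (c *: x).
Proof.
by apply/esym/quotAlg_piP; rewrite -scalerBr; apply: IZ; apply: quotAlg_repr.
Qed.

Lemma qmulE x y : qmul (\pi_quotAlg x) (\pi_quotAlg y) = \pi_quotAlg (x ** y).
Proof.
apply/esym/quotAlg_piP; set x' := repr _; set y' := repr _.
have -> : x ** y - x' ** y' = x ** (y - y') + y' ** (x - x').
  rewrite -!scaleN1r !namulDr !namulZr (namulC y' x) (namulC y' x') !scaleN1r.
  by rewrite addrA subrK.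
by apply: ID; apply: IM; apply: quotAlg_repr.
Qed.

Let piK (u : quotAlg) : \pi_quotAlg (repr u) = u. Proof. exact: reprK. Qed.

Fact qaddA : associative qadd.
Proof. by move=> u v w; rewrite -[u]piK -[v]piK -[w]piK !qaddE addrA. Qed.
Fact qaddC : commutative qadd.
Proof. by move=> u v; rewrite -[u]piK -[v]piK !qaddE addrC. Qed.
Fact qadd0 : left_id qzero qadd.
Proof. by move=> u; rewrite -[u]piK /qzero !qaddE add0r. Qed.
Fact qaddN : left_inverse qzero qopp qadd.
Proof. by move=> u; rewrite -[u]piK qoppE qaddE addNr. Qed.

HB.instance Definition _ :=
  GRing.isZmodule.Build quotAlg qaddA qaddC qadd0 qaddN.

Fact qscaleA (c d : K) u : qscale c (qscale d u) = qscale (c * d) u.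
Proof. by rewrite -[u]piK !qscaleE scalerA. Qed.
Fact qscale1 : left_id 1 qscale.
Proof. by move=> u; rewrite -[u]piK qscaleE scale1r. Qed.
Fact qscaleDr : right_distributive qscale +%R.
Proof.
move=> c u v; rewrite -[u]piK -[v]piK.
by rewrite [_ + _]qaddE !qscaleE [RHS]qaddE scalerDr.
Qed.
Fact qscaleDl u : {morph qscale^~ u : c d / c + d}.
Proof. by move=> c d; rewrite -[u]piK !qscaleE [RHS]qaddE scalerDl. Qed.

HB.instance Definition _ :=
  GRing.Zmodule_isLmodule.Build K quotAlg qscaleA qscale1 qscaleDr qscaleDl.

Fact qmulC : commutative qmul.
Proof. by move=> u v; rewrite -[u]piK -[v]piK !qmulE namulC. Qed.
Fact qmulDl : left_distributive qmul +%R.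
Proof.
move=> u v w; rewrite -[u]piK -[v]piK -[w]piK.
by rewrite [_ + _]qaddE !qmulE [RHS]qaddE namulDl.
Qed.
Fact qmulZl (c : K) u v : qmul (c *: u) v = c *: qmul u v.
Proof.
rewrite -[u]piK -[v]piK.
by rewrite [_ *: _]qscaleE !qmulE [RHS]qscaleE namulZl.
Qed.

HB.instance Definition _ :=
  Lmodule_isComNAAlg.Build K quotAlg qmulC qmulDl qmulZl.

End Quotient.

Section BtreeChoice.
Variable T : Type.

Fixpoint btree_enc (t : btree T) : GenTree.tree T :=
  match t with
  | Leaf x => GenTree.Leaf x
  | Node l r => GenTree.Node 0 [:: btree_enc l; btree_enc r]
  end.

Fixpoint btree_dec (u : GenTree.tree T) : option (btree T) :=
  match u with
  | GenTree.Leaf x => Some (Leaf x)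
  | GenTree.Node _ [:: l; r] =>
      if (btree_dec l, btree_dec r) is (Some l', Some r')
      then Some (Node l' r') else None
  | _ => None
  end.

Lemma btree_encK : pcancel btree_enc btree_dec.
Proof. by elim=> //= l -> r ->. Qed.

End BtreeChoice.

HB.instance Definition _ (T : choiceType) :=
  Choice.copy (btree T) (pcan_type (@btree_encK T)).

Section Monomials.
Variable X : choiceType.
Implicit Types s t : btree X.

(* The congruence generated by the commutativity of Node. *)
Fixpoint comm_eqb s t : bool :=
  match s, t with
  | Leaf x, Leaf y => x == y
  | Node a b, Node c d =>
      (comm_eqb a c && comm_eqb b d) || (comm_eqb a d && comm_eqb b c)
  | _, _ => false
  end.

Lemma comm_eqb_refl : reflexive comm_eqb.
Proof. by elim=> [x|a IHa b IHb] /=; rewrite ?eqxx ?IHa ?IHb. Qed.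

Lemma comm_eqb_sym : symmetric comm_eqb.
Proof.
elim=> [x|a IHa b IHb] [y|c d] //=.
by rewrite IHa IHb (IHa d) (IHb c) (andbC (comm_eqb d a)).
Qed.

Lemma comm_eqb_trans : transitive comm_eqb.
Proof.
elim=> [y|c IHc d IHd] [x|a b] [z|e f] //=; first by move=> /eqP ->.
by case/orP=> /andP[h1 h2] /orP[] /andP[h3 h4]; apply/orP;
  [left|right|right|left]; apply/andP; split; eauto.
Qed.

Canonical comm_equiv :=
  EquivRel comm_eqb comm_eqb_refl comm_eqb_sym comm_eqb_trans.

(* Commutative nonassociative monomials in the generators X. *)
Definition cmon : Type := {eq_quot comm_equiv}.

HB.instance Definition _ := Choice.on cmon.
HB.instance Definition _ := EqQuotient.on cmon.

Definition cmmul (m1 m2 : cmon) : cmon := \pi_cmon (Node (repr m1) (repr m2)).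

Definition cmdeg (m : cmon) : nat := leaves (repr m).

Lemma cmon_eqP s t : reflect (\pi_cmon s = \pi_cmon t) (comm_eqb s t).
Proof.
by rewrite -[comm_eqb s t](eqquotE cmon); apply: eqP.
Qed.

Lemma comm_eqb_repr t : comm_eqb (repr (\pi_cmon t)) t.
Proof. by apply/cmon_eqP; rewrite reprK. Qed.

Lemma cmmulE s t : cmmul (\pi_cmon s) (\pi_cmon t) = \pi_cmon (Node s t).
Proof. by apply/cmon_eqP; rewrite /= !comm_eqb_repr. Qed.

Lemma cmmulC : commutative cmmul.
Proof. by move=> m1 m2; apply/cmon_eqP; rewrite /= !comm_eqb_refl orbT. Qed.

Lemma comm_eqb_leaves s t : comm_eqb s t -> leaves s = leaves t.
Proof.
elim: s t => [x|a IHa b IHb] [y|c d] //=.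
by case/orP=> /andP[/IHa -> /IHb ->] //; rewrite addnC.
Qed.

Lemma cmdegE t : cmdeg (\pi_cmon t) = leaves t.
Proof. exact/comm_eqb_leaves/comm_eqb_repr. Qed.

End Monomials.

Lemma finite_cmdeg_lt (k n : nat) :
  finite_set [set m : cmon 'I_k | (cmdeg m < n)%N].
Proof.
suff h : finite_set [set t : btree 'I_k | (leaves t < n)%N].
  apply: sub_finite_set (finite_image (\pi_(cmon 'I_k)) h) => m /= mn.
  by exists (repr m) => //; rewrite reprK.
elim: n => [|n IHn]; first by apply: sub_finite_set (finite_set0 _).
have fL : finite_set (range (@Leaf 'I_k)) by apply: finite_image.
have fN := finite_image2 (@Node 'I_k) IHn IHn.
apply: sub_finite_set (_ : _ `<=` _ `|` _) _; last by rewrite finite_setU; split; [exact: fL|exact: fN].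
have l0 (t : btree 'I_k) : (0 < leaves t)%N.
  by elim: t => //= l hl r hr; rewrite addn_gt0 hl.
case=> [x|l r] /= hlr; [by left; exists x|right].
exists l; last exists r => //=.
  by apply: leq_trans (_ : leaves l + leaves r <= n)%N => //; rewrite -addn1 leq_add2l.
by apply: leq_trans (_ : leaves l + leaves r <= n)%N => //; rewrite -add1n leq_add2r.
Qed.

(* This is dim[n,k]; fset_set is meaningful here by finite_cmdeg_lt. *)
Definition dim_lt (n k : nat) : nat :=
  #|` fset_set [set m : cmon 'I_k | (cmdeg m < n)%N] |.

Section FreeAlgebra.
Variables (K : fieldType) (X : choiceType).

(* The free K-module on the monomials, with the bilinear extension of cmmul. *)
Definition freeCom : Type := {malg K[cmon X]}.

HB.instance Definition _ := GRing.Lmodule.on freeCom.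

Implicit Types f g h : freeCom.

Definition fcmul f g : freeCom :=
  \sum_(m1 <- msupp f) \sum_(m2 <- msupp g) << f@_m1 * g@_m2 *g cmmul m1 m2 >>.

Lemma fcmulw (d1 d2 : {fset cmon X}) f g :
  (msupp f `<=` d1)%fset -> (msupp g `<=` d2)%fset ->
  fcmul f g =
  \sum_(m1 <- d1) \sum_(m2 <- d2) << f@_m1 * g@_m2 *g cmmul m1 m2 >>.
Proof.
move=> le1 le2; rewrite /fcmul (big_fset_incl _ le1) /=; last first.
  move=> m1 _ /mcoeff_outdom ->; rewrite big1 // => m2 _.
  by rewrite mul0r monalgU0.
apply: eq_bigr => m1 _; apply: (big_fset_incl _ le2) => m2 _ /mcoeff_outdom ->.
by rewrite mulr0 monalgU0.
Qed.

Fact fcmulC : commutative fcmul.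
Proof.
move=> f g; rewrite /fcmul exchange_big /=; apply: eq_bigr => m1 _.
by apply: eq_bigr => m2 _; rewrite mulrC cmmulC.
Qed.

Fact fcmulDl : left_distributive fcmul +%R.
Proof.
move=> f g h; pose d := (msupp f `|` msupp g)%fset.
rewrite (@fcmulw d (msupp h) (f + g)) ?msuppD_le ?fsubset_refl //.
rewrite (@fcmulw d (msupp h) f) ?fsubsetUl ?fsubset_refl //.
rewrite (@fcmulw d (msupp h) g) ?fsubsetUr ?fsubset_refl //.
rewrite -big_split /=; apply: eq_bigr => m1 _.
rewrite -big_split /=; apply: eq_bigr => m2 _.
by rewrite mcoeffD mulrDl monalgUD.
Qed.

Fact fcmulZl (c : K) f g : fcmul (c *: f) g = c *: fcmul f g.
Proof.
rewrite (@fcmulw (msupp f) (msupp g)) ?msuppZ_le ?fsubset_refl //.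
rewrite /fcmul scaler_sumr; apply: eq_bigr => m1 _.
rewrite scaler_sumr; apply: eq_bigr => m2 _.
by apply/malgP => m; rewrite !(mcoeffZ, mcoeffU) -mulrA mulrnAr.
Qed.

HB.instance Definition _ :=
  Lmodule_isComNAAlg.Build K freeCom fcmulC fcmulDl fcmulZl.

Lemma freeCom_mulUU (c d : K) (m1 m2 : cmon X) :
  (<< c *g m1 >> : freeCom) ** << d *g m2 >> = << c * d *g cmmul m1 m2 >>.
Proof.
rewrite [LHS](fcmulw msuppU_le msuppU_le) !big_seq_fset1.
by rewrite !mcoeffUU.
Qed.

End FreeAlgebra.

(* The free commutative K-algebra on k generators with identity x^3 = 0. *)
Definition freeComNil3 (K : fieldType) (k : nat) : comNAAlgType K :=
  quotAlg (range (@cube K (freeCom K 'I_k))).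

Lemma freeComNil3_cube (K : fieldType) (k : nat) (u : freeComNil3 K k) :
  cube u = 0.
Proof.
rewrite /cube -[u]reprK [X in _ ** X]qmulE [LHS]qmulE.
apply: quotAlg_piP; rewrite subr0 => B [_]; apply.
by exists (repr u).
Qed.

(* Main.v *)
(* Write L_a for multiplication by a, c = x^3, T(a,b,c) = a(bc) + b(ac) + c(ab) and
   delta = 2 gamma - 1.

   The cube ideal I. Linearizing the identity gives L_x^3 = -gamma L_c and
   L_x L_{x^2} = delta L_c, whence 4 gamma x^3 a = T(x,x^2,a) - T(x,x,xa): the span of
   the cubes is already an ideal. Its square is zero: every operator of degree 4 in x
   is a multiple of P = L_x L_c, and in degree 4 in x and 2 in y all products involving
   c reduce to multiples of s = y(Py), for which 8 delta^2 s = 0. So x^3 T(x,y,y) = 0,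
   which linearizes to x^3 y^3 = 0.

   The bound. Modulo operator words with fewer letters (where a product of two letters
   counts as one letter), xay + yax = delta (axy + ayx) and
   xya + yxa = -2 gamma (axy + ayx); hence a word in which a letter occurs three times
   reduces to shorter words. Take as letters the monomials in the generators: those of
   degree at least n lie in I, hence kill I. So a word on I of total degree larger than
   2 (n-1) dim[n,k] vanishes. A product of 2^D elements contains D nested
   multiplications, the innermost n-1 of which already produce an element of I.

   Existence of n. If x^3 = 0 then L_{ab} = -(L_a L_b + L_b L_a). Argue by induction on
   the number of generators, x being the last one: modulo words with fewer letters
   different from x, the monomials in the other generators anticommute, also across x
   and x^2, and L_x^3 = 0. So repeated letters vanish, there are finitely many letters,
   and words are bounded. *)
Require Import Defs.
From HB Require Import structures.
From mathcomp Require Import all_boot all_order all_algebra.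
From mathcomp Require Import boolp classical_sets.
From mathcomp Require Import functions cardinality finmap monalg.
From mathcomp Require Import ring zify.

Set Implicit Arguments.
Unset Strict Implicit.
Unset Printing Implicit Defensive.

Import GRing.Theory.
Local Open Scope ring_scope.

(* The square-zero extension of K by A is a commutative ring, so that [ring]
   decides linear identities in A. *)
Section TrivialExtension.
Variables (K : fieldType) (A : lmodType K).

Definition triv : Type := (K * A)%type.

HB.instance Definition _ := GRing.Zmodule.on triv.

Definition tmul (u v : triv) : triv := (u.1 * v.1, u.1 *: v.2 + v.1 *: u.2).

Fact tmulC : commutative tmul.
Proof. by move=> u v; rewrite /tmul mulrC addrC. Qed.

Fact tmulA : associative tmul.
Proof.
move=> u v w; rewrite /tmul /= mulrA !scalerDr !scalerA addrA.
by rewrite ![w.1 * _]mulrC.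
Qed.

Fact tmul1 : left_id ((1, 0) : triv) tmul.
Proof. by move=> [a b]; rewrite /tmul /= mul1r scale1r scaler0 addr0. Qed.

Fact tmulD : left_distributive tmul +%R.
Proof.
move=> u v w; rewrite /tmul /= mulrDl scalerDl scalerDr.
congr pair; exact: addrACA.
Qed.

Fact tone : ((1, 0) : triv) != 0.
Proof. by apply/eqP => -[/eqP]; rewrite oner_eq0. Qed.

HB.instance Definition _ :=
  GRing.Zmodule_isComNzRing.Build triv tmulA tmulC tmul1 tmulD tone.

Definition tinr (a : A) : triv := (0, a).

Definition tinl (c : K) : triv := (c, 0).

Fact tinr_add : nmod_morphism tinr.
Proof. by split=> // a b; rewrite /tinr; congr pair; rewrite addr0. Qed.

HB.instance Definition _ := GRing.isNmodMorphism.Build A triv tinr tinr_add.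

Fact tinl_add : nmod_morphism tinl.
Proof. by split=> // a b; rewrite /tinl; congr pair; rewrite addr0. Qed.

Fact tinl_mul : monoid_morphism tinl.
Proof. by split=> // a b; rewrite /tinl; congr pair; rewrite /= !scaler0 addr0. Qed.

HB.instance Definition _ := GRing.isNmodMorphism.Build K triv tinl tinl_add.

HB.instance Definition _ := GRing.isMonoidMorphism.Build K triv tinl tinl_mul.

Lemma tinrZ c a : tinr (c *: a) = tinl c * tinr a.
Proof. by rewrite /tinr; congr pair => /=; rewrite ?mulr0 // scale0r addr0. Qed.

Lemma tinr_inj : injective tinr. Proof. by move=> a b []. Qed.

Lemma tinrD a b : tinr (a + b) = tinr a + tinr b. Proof. exact: raddfD. Qed.

Lemma tinrN a : tinr (- a) = - tinr a. Proof. exact: raddfN. Qed.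

Lemma tinrMn a n : tinr (a *+ n) = tinr a *+ n. Proof. exact: raddfMn. Qed.

End TrivialExtension.

Ltac module := apply: tinr_inj; rewrite ?(tinrD, tinrN, tinrZ, tinrMn, raddf0); ring.

(** Elimination by hand: [k] is the coefficient with which a known equation enters the goal, and
    [module] checks what remains. *)
Lemma lincomb (K : fieldType) (A : lmodType K) (k : K) (l1 r1 l r : A) :
  l1 = r1 -> l - k *: l1 = r - k *: r1 -> l = r.
Proof. by move=> <- /addIr. Qed.

(** * Operator identities derived from the cubic identity *)

Section CubicIdentity.
Variables (K : fieldType) (A : comNAAlgType K).
Implicit Types a b c d x y z : A.

(** Half of the full linearization of the cube, by [ctri_cube]. *)
Definition ctri a b c : A := a ** (b ** c) + b ** (a ** c) + c ** (a ** b).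

Definition namulE := (@namulDl K A, @namulDr K A, @namulZl K A, @namulZr K A).

Lemma namul0r a : a ** 0 = 0.
Proof. by rewrite -[0 in LHS](scale0r 0) namulZr scale0r. Qed.

Lemma namul0l a : 0 ** a = 0.
Proof. by rewrite namulC namul0r. Qed.

Lemma namulrN a b : a ** (- b) = - (a ** b).
Proof. by rewrite -scaleN1r namulZr scaleN1r. Qed.

Lemma ctri_cube a b c :
  2 *: ctri a b c = cube (a + b + c) - cube (a + b) - cube (a + c)
    - cube (b + c) + cube a + cube b + cube c.
Proof.
rewrite /cube /ctri !namulE (namulC b a) (namulC c a) (namulC c b); module.
Qed.

Lemma ctri_diag a : ctri a a a = 3 *: cube a.
Proof. rewrite /ctri /cube; module. Qed.

Variable gamma : K.
Hypotheses (two0 : 2 != 0 :> K) (three0 : 3 != 0 :> K).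
Hypotheses (gamma0 : gamma != 0) (gammaN1 : gamma + 1 != 0).
Hypothesis delta0 : 2 * gamma - 1 != 0.
Hypothesis LA : Lcube_identity A gamma.

(** Inclusion and exclusion over [a], [b], [c] keeps exactly the part of [f] that is linear in each
    of them. *)
Lemma Lcube_polar a b c d :
  a ** (b ** (c ** d)) + a ** (c ** (b ** d)) + b ** (a ** (c ** d))
  + b ** (c ** (a ** d)) + c ** (a ** (b ** d)) + c ** (b ** (a ** d))
  = - (2 * gamma) *: (d ** ctri a b c).
Proof.
pose f x := x ** (x ** (x ** d)) + gamma *: (d ** (x ** (x ** x))).
have f0 x : f x = 0 by rewrite /f (namulC d); exact: LA.
suff: f (a + b + c) - f (a + b) - f (a + c) - f (b + c) + f a + f b + f c = 0.
  move=> fE; apply: (lincomb (k := 1) fE); rewrite /f /ctri !namulE.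
  rewrite (namulC b a) (namulC c a) (namulC c b); module.
by rewrite !f0 !subr0 !addr0.
Qed.

(** Add the four instances of [Lcube_polar]: the left sides give twice this sum, the right sides
    [- (2 * gamma)] times it. *)
Lemma ctri_polar a b c d :
  d ** ctri a b c + c ** ctri a b d + b ** ctri a c d + a ** ctri b c d = 0.
Proof.
apply: (scalerI (mulf_neq0 two0 gammaN1)); rewrite scaler0.
apply: (lincomb (k := 1) (Lcube_polar a b c d)).
apply: (lincomb (k := 1) (Lcube_polar a b d c)).
apply: (lincomb (k := 1) (Lcube_polar a c d b)).
apply: (lincomb (k := 1) (Lcube_polar b c d a)).
rewrite /ctri !namulE.
rewrite (namulC b a) (namulC c a) (namulC d a) (namulC c b) (namulC d b) (namulC d c).
module.
Qed.

(** Linearizes L_x L_{x^2} = delta L_c: the left side is what [ctri_polar] contains besides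
    [Lcube_polar] and [d ** ctri a b c]. *)
Lemma Lsq_polar a b c d :
  a ** (d ** (b ** c)) + b ** (d ** (a ** c)) + c ** (d ** (a ** b))
  = (2 * gamma - 1) *: (d ** ctri a b c).
Proof.
apply: (lincomb (k := -1) (Lcube_polar a b c d)).
apply: (lincomb (k := 1) (ctri_polar a b c d)).
rewrite /ctri !namulE; module.
Qed.

Section FixedElement.
Variable x : A.
Local Notation c := (cube x).
Local Notation V := (x ** x).

Lemma LLL_cube a : x ** (x ** (x ** a)) = - gamma *: (c ** a).
Proof. by apply/eqP; rewrite scaleNr -addr_eq0; apply/eqP/LA. Qed.

Lemma L_Lsq a : x ** (V ** a) = (2 * gamma - 1) *: (c ** a).
Proof.
apply: (scalerI three0); apply: (lincomb (k := 1) (Lsq_polar x x x a)).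
rewrite ctri_diag !namulE !(namulC _ a); module.
Qed.

(** The identity at [a = x] reads [x ** c = - gamma *: (c ** x)]. *)
Lemma mul_cube : x ** c = 0.
Proof.
apply: (scalerI gammaN1); rewrite scaler0.
apply: (lincomb (k := 1) (LLL_cube x)); rewrite (namulC c x) -/(cube x); module.
Qed.

(** Two ways to evaluate the fourth power of L_x. *)
Lemma L_cubeC a : c ** (x ** a) = x ** (c ** a).
Proof.
apply: (scalerI gamma0); apply: (lincomb (k := 1) (LLL_cube (x ** a))).
rewrite (LLL_cube a) namulZr; module.
Qed.

Lemma Lsq_ctri a : V ** ctri x x a = - 2 *: (x ** (c ** a)).
Proof.
apply: (scalerI (mulf_neq0 two0 gamma0)).
apply: (lincomb (k := 1) (Lcube_polar x x a V)).
rewrite (namulC a V) L_Lsq namulZr -/(cube x) mul_cube namul0r (namulC a c).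
module.
Qed.

Lemma Lsq_Lsq a :
  V ** (V ** a) + 2 *: (x ** (c ** a)) = (2 * gamma - 1) *: ((V ** V) ** a).
Proof.
apply: (lincomb (k := 1) (Lsq_polar x x V a)).
rewrite /ctri -/(cube x) mul_cube !(namulC a) add0r add0r; module.
Qed.

Lemma Lsq_L_L a : V ** (x ** (x ** a)) =
  - gamma *: ((V ** V) ** a) - (2 * (2 * gamma - 1)) *: (x ** (c ** a)).
Proof.
apply: (scalerI two0); apply: (lincomb (k := 1) (Lcube_polar x x V a)).
rewrite L_Lsq (L_Lsq (x ** a)) !namulZr L_cubeC.
rewrite /ctri -/(cube x) mul_cube (namulC a) add0r add0r; module.
Qed.

(** Put W = L_{V^2} and P = L_x L_c. [Lsq_ctri] says L_V (L_V + 2 L_x^2) = -2 P, and [Lsq_Lsq],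
    [Lsq_L_L] express both summands by W and P; W survives with coefficient -1. *)
Lemma L_sq_sq a : (V ** V) ** a = - (4 * (2 * gamma - 1)) *: (x ** (c ** a)).
Proof.
apply: (lincomb (k := 1) (Lsq_Lsq a)).
apply: (lincomb (k := 2) (Lsq_L_L a)).
apply: (lincomb (k := -1) (Lsq_ctri a)).
rewrite /ctri !namulE (namulC a); module.
Qed.

Lemma Lsq_Lsq_val a :
  V ** (V ** a) = - (4 * (2 * gamma - 1) ^+ 2 + 2) *: (x ** (c ** a)).
Proof.
apply: (lincomb (k := 1) (Lsq_Lsq a)); rewrite L_sq_sq; module.
Qed.

End FixedElement.
End CubicIdentity.

(** * Products of two cubes *)

Section CubeProducts.
Variables (K : fieldType) (A : comNAAlgType K) (gamma : K).
Implicit Types a b c d x y z : A.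
Hypotheses (two0 : 2 != 0 :> K) (three0 : 3 != 0 :> K).
Hypotheses (gamma0 : gamma != 0) (gammaN1 : gamma + 1 != 0).
Hypothesis delta0 : 2 * gamma - 1 != 0.
Hypothesis LA : Lcube_identity A gamma.

(** The left side is [q + 2 *: r]. Once [q] and [r] are known as multiples of [s], it equals
    [- 2 *: s], so it suffices that [s] vanishes. *)
Lemma cube_mul_ctri x y : cube x ** ctri x y y = 0.
Proof.
set c := cube x; set V := x ** x.
pose s := y ** (x ** (c ** y)); pose q := x ** (c ** (y ** y)).
pose r := c ** (y ** (x ** y)); pose w := x ** (y ** (c ** y)).
pose X := V ** (y ** (V ** y)).
have xc : x ** c = 0 := mul_cube gammaN1 LA x.
have cx a : c ** (x ** a) = x ** (c ** a) := L_cubeC gamma0 LA x a.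
have E1 : 2 *: s + q = (2 * gamma - 1) *: (2 *: w + q).
  have := Lsq_polar two0 gammaN1 LA y y c x.
  rewrite /ctri !namulE (namulC y c) (cx (y ** y)) -/s -/q -/w.
  move=> e; apply: (lincomb (k := 1) e); module.
have E2 : 2 *: s + q = (2 * gamma - 1) *: (2 *: r + q).
  have := Lsq_polar two0 gammaN1 LA y y x c.
  rewrite /ctri !namulE (namulC y x) !cx -/s -/q -/r.
  move=> e; apply: (lincomb (k := 1) e); module.
have E3 : w = - q - r - 2 *: s.
  have := ctri_polar two0 gammaN1 LA x y y c.
  rewrite /ctri !namulE (namulC y c) xc !namul0r.
  rewrite !cx -/s -/q -/r -/w => e.
  apply: (scalerI two0); apply: (lincomb (k := 1) e); module.
have wr : w = r.
  apply: (scalerI (mulf_neq0 two0 delta0)).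
  apply: (lincomb (k := -1) E1); apply: (lincomb (k := 1) E2); module.
have rs : r = (2 * gamma - 1) *: s.
  apply: (scalerI two0); apply: (lincomb (k := -1) E2).
  apply: (lincomb (k := 2 - 2 * gamma) E3); rewrite wr; module.
have qs : q = - (4 * gamma) *: s.
  apply: (lincomb (k := 1) E3); rewrite wr rs; module.
(* From here [x] enters through [V] only; the values of L_V^2 and L_{V^2} bring back [s] and [q],
   and [X] is the one new unknown. *)
have E4 : (1 + 2 * gamma) *: X = (4 * (2 * gamma - 1)) *: s
    + (4 * (2 * gamma - 1) ^+ 2 + 2) *: (s + gamma *: q).
  have := Lcube_polar LA y y V V.
  rewrite /ctri !namulE (namulC y (V ** V)) (namulC y V).
  rewrite (L_sq_sq two0 three0 gamma0 gammaN1 LA).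
  rewrite !(Lsq_Lsq_val two0 three0 gamma0 gammaN1 LA) !namulE -/c -/s -/q -/X.
  by move=> e; apply: (scalerI two0); apply: (lincomb (k := 1) e); module.
have E5 : (4 * (2 * gamma - 1) ^+ 2 + 2) *: (2 *: s + q) =
    (2 * gamma - 1) *: ((4 * (2 * gamma - 1) ^+ 2 + 2) *: q - 2 *: X).
  have := Lsq_polar two0 gammaN1 LA y y V V.
  rewrite /ctri !namulE (namulC y V).
  rewrite !(Lsq_Lsq_val two0 three0 gamma0 gammaN1 LA) !namulE -/c -/s -/q -/X.
  by move=> e; apply: (lincomb (k := -1) e); module.
have s0 : s = 0.
  have k0 : 8 * (2 * gamma - 1) ^+ 2 != 0.
    rewrite (_ : 8 = 2 * 2 * 2); last by ring.
    by rewrite !mulf_neq0 // expf_neq0.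
  apply: (scalerI k0); rewrite scaler0.
  (* The two multipliers cancel [X]. *)
  apply: (lincomb (k := - 2 * (2 * gamma - 1)) E4).
  apply: (lincomb (k := 1 + 2 * gamma) E5); rewrite qs; module.
rewrite /ctri !namulE cx -/q -/r; rewrite qs rs s0; module.
Qed.

Lemma cube_expand (k : K) x y : cube (x + k *: y) =
  cube x + k *: ctri x x y + k ^+ 2 *: ctri x y y + k ^+ 3 *: cube y.
Proof. rewrite /cube /ctri !namulE (namulC y x); module. Qed.

(** [cube_mul_ctri] at [x + k *: y] is a polynomial in [k]. Its odd part has terms in [k] and
    [k ^+ 3] only, which the values 1 and 2 separate up to the factor 48 = 2^4 * 3. *)
Lemma cube_mul_ctri_polar x y :
  3 *: (cube x ** cube y) + ctri x x y ** ctri x y y = 0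
  /\ cube y ** ctri x y y = 0.
Proof.
have ctri_expand (k : K) :
    ctri (x + k *: y) y y = ctri x y y + (3 * k) *: cube y.
  rewrite /cube /ctri !namulE; module.
have P0 (k : K) := cube_mul_ctri (x + k *: y) y.
have {}P0 (k : K) : (cube x + k *: ctri x x y + k ^+ 2 *: ctri x y y
    + k ^+ 3 *: cube y) ** (ctri x y y + (3 * k) *: cube y) = 0.
  by rewrite -cube_expand -ctri_expand.
move: (ctri x x y) (ctri x y y) P0 => D E P0.
have odd (k : K) : 2 *: (k *: (3 *: (cube x ** cube y) + D ** E)
    + k ^+ 3 *: (4 *: (cube y ** E))) = 0.
  have := P0 k; have := P0 (- k).
  rewrite !namulE => e1 e2.
  apply: (lincomb (k := 1) e2); apply: (lincomb (k := -1) e1).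
  rewrite (namulC E); module.
have yE0 : cube y ** E = 0.
  apply: (scalerI (mulf_neq0 (expf_neq0 4 two0) three0)); rewrite scaler0.
  by apply: (lincomb (k := 1) (odd 2)); apply: (lincomb (k := -2) (odd 1)); module.
split=> //; apply: (scalerI two0); apply: (lincomb (k := 1) (odd 1)).
rewrite yE0; module.
Qed.

(** The part of the square of [cube (x + y)] that is odd in [y] gives
    [cube x ** cube y + D ** E = 0]; in [cube_mul_ctri_polar] the first term has coefficient 3
    instead. *)
Lemma cube_mul_cube x y : cube x ** cube y = 0.
Proof.
have sq0 z : cube z ** cube z = 0.
  apply: (scalerI three0); rewrite scaler0 -namulZr -ctri_diag.
  exact: cube_mul_ctri.
have [t1 yE0] := cube_mul_ctri_polar x y.
have [_ xD0] := cube_mul_ctri_polar y x.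
have {}xD0 : cube x ** ctri x x y = 0.
  by rewrite -xD0; congr (_ ** _); rewrite /ctri (namulC y x); module.
have := sq0 (x + (-1) *: y); have := sq0 (x + 1 *: y).
rewrite !cube_expand.
move: (ctri x x y) (ctri x y y) t1 yE0 xD0 => D E t1 yE0 xD0.
rewrite !namulE !sq0 (namulC D (cube x)) (namulC D (cube y)) (namulC E D).
rewrite (namulC E (cube x)) (namulC (cube y) (cube x)) (namulC E (cube y)).
rewrite yE0 xD0 => e1 e2.
apply: (scalerI (expf_neq0 3 two0)); rewrite scaler0.
apply: (lincomb (k := -1) e1); apply: (lincomb (k := 1) e2).
apply: (lincomb (k := 4) t1); module.
Qed.

(** After cancellation the right side is x(x^2 a) - 2 x(x(xa)) + x^3 a. This makes the span of the
    cubes an ideal. *)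
Lemma cube_mul_sum x a : (4 * gamma) *: (cube x ** a) =
  ctri x (x ** x) a - ctri x x (x ** a).
Proof.
apply: (lincomb (k := -1) (L_Lsq two0 three0 gammaN1 LA x a)).
apply: (lincomb (k := 2) (LLL_cube LA x a)).
rewrite /ctri -/(cube x) (namulC a (cube x)).
rewrite (namulC (x ** a)); module.
Qed.
End CubeProducts.

(** * Linear spans *)

Section Span.
Variables (K : fieldType) (A : comNAAlgType K).
Implicit Types (S B : set A) (x y z : A).

Inductive lspan S : set A :=
| LSpan0 : lspan S 0
| LSpanD (c : K) x y : S x -> lspan S y -> lspan S (c *: x + y).

Lemma sub_lspan S x : S x -> lspan S x.
Proof.
by move=> Sx; rewrite -[x]scale1r -[_ *: x]addr0; apply: LSpanD; last constructor.
Qed.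

Lemma lspan_comb S (c : K) x y : lspan S x -> lspan S y -> lspan S (c *: x + y).
Proof.
move=> Sx Sy; elim: Sx => [|d u v Su _ IH]; first by rewrite scaler0 add0r.
by rewrite scalerDr scalerA -addrA; apply: LSpanD.
Qed.

Lemma lspanD S x y : lspan S x -> lspan S y -> lspan S (x + y).
Proof. by rewrite -{2}[x]scale1r; apply: lspan_comb. Qed.

Lemma lspanZ S (c : K) x : lspan S x -> lspan S (c *: x).
Proof. by move=> Sx; rewrite -[_ *: _]addr0; apply: lspan_comb => //; constructor. Qed.

Lemma lspanB S x y : lspan S x -> lspan S y -> lspan S (x - y).
Proof. by move=> Sx Sy; rewrite -scaleN1r; apply/lspanD/lspanZ. Qed.

Lemma lspan_min S B : B 0 -> (forall (c : K) x y, B x -> B y -> B (c *: x + y)) ->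
  (S `<=` B -> lspan S `<=` B)%classic.
Proof. by move=> B0 Bc SB x; elim=> // c u v Su _; apply: Bc => //; apply: SB. Qed.

Lemma lspan_sub S S' : (S `<=` S' -> lspan S `<=` lspan S')%classic.
Proof.
move=> sSS; apply: lspan_min; [exact: LSpan0 | exact: lspan_comb |].
by move=> x /sSS; apply: sub_lspan.
Qed.

Lemma lspan_mul S S' S'' x y :
  (forall u v, S u -> S' v -> lspan S'' (u ** v)) ->
  lspan S x -> lspan S' y -> lspan S'' (x ** y).
Proof.
move=> SS Sx Sy; elim: Sx => [|c u v Su _ IH]; first by rewrite namul0l; constructor.
rewrite namulDl namulZl; apply: lspan_comb => // {v IH}.
elim: Sy => [|d v w Sv _ IH]; first by rewrite namul0r; constructor.
by rewrite namulDr namulZr; apply: lspan_comb => //; apply: SS.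
Qed.

Lemma lspan_set0 S x : (forall u, S u -> u = 0) -> lspan S x -> x = 0.
Proof. by move=> S0; elim=> // c u v /S0-> _ ->; rewrite scaler0 addr0. Qed.

End Span.

(** * The span of the cubes as an ideal of square zero *)

Section CubeIdeal.
Variables (K : fieldType) (A : comNAAlgType K) (gamma : K).
Hypotheses (two0 : 2 != 0 :> K) (three0 : 3 != 0 :> K).
Hypotheses (gamma0 : gamma != 0) (gammaN1 : gamma + 1 != 0).
Hypothesis delta0 : 2 * gamma - 1 != 0.
Hypothesis LA : Lcube_identity A gamma.

Definition cube_span : set A := lspan (range (@cube K A)).

Lemma cube_span_cube x : cube_span (cube x).
Proof. by apply: sub_lspan; exists x. Qed.

Lemma ctri_cube_span a b c : cube_span (ctri a b c).
Proof.
rewrite -[ctri _ _ _]scale1r -(mulVf two0) -scalerA ctri_cube.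
apply: lspanZ.
by repeat first [exact: cube_span_cube | apply: lspanB | apply: lspanD].
Qed.

Lemma cube_span_mulr x a : cube_span x -> cube_span (a ** x).
Proof.
elim=> [|c _ y [u _ <-] _ IH]; first by rewrite namul0r; constructor.
rewrite namulDr namulZr; apply: lspan_comb => //.
have g4 : 4 * gamma != 0.
  by rewrite mulf_neq0 // (_ : 4 = 2 * 2) ?mulf_neq0 //; ring.
rewrite namulC -[_ ** _]scale1r -(mulVf g4) -scalerA.
rewrite (cube_mul_sum two0 three0 gammaN1 LA).
by apply/lspanZ/lspanB; exact: ctri_cube_span.
Qed.

Lemma cube_span_mul0 x y : cube_span x -> cube_span y -> x ** y = 0.
Proof.
elim=> [|c _ z [u _ <-] _ IH] Sy; first by rewrite namul0l.
rewrite namulDl namulZl IH // addr0.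
elim: Sy => [|d _ v [w _ <-] _ IHv]; first by rewrite namul0r scaler0.
rewrite namulDr namulZr (cube_mul_cube two0 three0 gamma0 gammaN1 delta0 LA).
by rewrite scaler0 add0r.
Qed.

End CubeIdeal.

(** * Words in multiplication operators *)

Section Words.
Variables (K : fieldType) (A : comNAAlgType K) (X : Type) (ev : X -> A).
Implicit Types (w p q : seq X) (u v : A).

Definition act w v : A := foldr (fun m u => ev m ** u) v w.

Lemma act_cat p q v : act (p ++ q) v = act p (act q v).
Proof. by rewrite /act foldr_cat. Qed.

Lemma act0 w : act w 0 = 0.
Proof. by elim: w => //= m w ->; rewrite namul0r. Qed.

Lemma act_comb w (c : K) u v : act w (c *: u + v) = c *: act w u + act w v.
Proof. by elim: w => //= m w ->; rewrite namulDr namulZr. Qed.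

Lemma actD w u v : act w (u + v) = act w u + act w v.
Proof. by rewrite -{1}[u]scale1r act_comb scale1r. Qed.

Lemma actZ w (c : K) u : act w (c *: u) = c *: act w u.
Proof. by rewrite -[c *: u]addr0 act_comb act0 addr0. Qed.

Lemma actN w u : act w (- u) = - act w u.
Proof. by rewrite -scaleN1r actZ scaleN1r. Qed.

End Words.

Ltac perm_lia H := let P := fresh in
  apply/permP => P; rewrite -(permP H P); do 4 rewrite ?count_cat /=; lia.

(** * Words in which a letter occurs three times *)

(* [w0] fixes a multiset of letters; the two hypotheses are the relations
   between words on these letters that hold modulo shorter words. *)
Section TripleLetter.
Variables (K : fieldType) (A : lmodType K) (X : eqType) (gamma : K).
Variables (phi : seq X -> A) (w0 : seq X).
Hypotheses (two0 : 2 != 0 :> K) (gamma1 : 1 - gamma != 0).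
Implicit Types (p q w : seq X) (a x y : X).
Hypothesis phi_side : forall p q x y a, perm_eq (p ++ x :: y :: a :: q) w0 ->
  phi (p ++ x :: y :: a :: q) + phi (p ++ y :: x :: a :: q) =
  - (2 * gamma) *: (phi (p ++ a :: x :: y :: q) + phi (p ++ a :: y :: x :: q)).
Hypothesis phi_mid : forall p q x y a, perm_eq (p ++ x :: a :: y :: q) w0 ->
  phi (p ++ x :: a :: y :: q) + phi (p ++ y :: a :: x :: q) =
  (2 * gamma - 1) *: (phi (p ++ a :: x :: y :: q) + phi (p ++ a :: y :: x :: q)).

(** The symmetrized pair crosses one letter at the price of a factor [- (2 * gamma)], by
    [phi_side]. *)
Lemma phi_pair_move w p q x y : perm_eq (p ++ x :: y :: w ++ q) w0 ->
  phi (p ++ x :: y :: w ++ q) + phi (p ++ y :: x :: w ++ q) =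
  (- (2 * gamma)) ^+ size w
    *: (phi (p ++ w ++ x :: y :: q) + phi (p ++ w ++ y :: x :: q)).
Proof.
elim: w p => [|a w IH] p pw /=; first by rewrite expr0 scale1r.
rewrite phi_side // exprS -scalerA; congr (_ *: _).
have := IH (rcons p a); rewrite !cat_rcons => -> //.
perm_lia pw.
Qed.

(** For equal letters [phi_mid] reads 2 u = 2 delta u, and 2 - 2 delta = 4 (1 - gamma). *)
Lemma phi_cube p q x : perm_eq (p ++ x :: x :: x :: q) w0 ->
  phi (p ++ x :: x :: x :: q) = 0.
Proof.
move=> pw; apply: (scalerI (mulf_neq0 (mulf_neq0 two0 two0) gamma1)).
by rewrite scaler0; apply: (lincomb (k := 1) (phi_mid pw)); module.
Qed.

(** The pair [x], [x] travels right until it meets the third [x]. *)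
Lemma phi_square_letter w p q x : perm_eq (p ++ x :: x :: w ++ x :: q) w0 ->
  phi (p ++ x :: x :: w ++ x :: q) = 0.
Proof.
move=> pw; apply: (scalerI two0); rewrite scaler0.
apply: (lincomb (k := 1) (phi_pair_move pw)).
have := @phi_cube (p ++ w) q x; rewrite -catA => ->; last by perm_lia pw.
module.
Qed.

(** Induction on the first gap: [phi_pair_move] carries [x] and the letter [a] behind it across [w],
    and the three other words that appear vanish. *)
Lemma phi_triple w p w' q x : perm_eq (p ++ x :: w ++ x :: w' ++ x :: q) w0 ->
  phi (p ++ x :: w ++ x :: w' ++ x :: q) = 0.
Proof.
elim: w p => [|a w IH] p pw /=; first exact: phi_square_letter.
have e1 : phi (p ++ a :: x :: w ++ x :: w' ++ x :: q) = 0.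
  by have := IH (rcons p a); rewrite !cat_rcons; apply; perm_lia pw.
have e2 : phi (p ++ w ++ a :: x :: x :: w' ++ x :: q) = 0.
  have := @phi_square_letter w' (rcons (p ++ w) a) q x.
  by rewrite cat_rcons -catA; apply; perm_lia pw.
(* By [phi_mid], [x a x] is a multiple of [a x x], which [e2] kills. *)
have e3 : phi (p ++ w ++ x :: a :: x :: w' ++ x :: q) = 0.
  have := @phi_mid (p ++ w) (w' ++ x :: q) x x a; rewrite -!catA e2 => e3.
  apply: (scalerI two0); rewrite scaler0; apply: (lincomb (k := 1) (e3 _)).
    by perm_lia pw.
  module.
have := @phi_pair_move w p (x :: w' ++ x :: q) x a.
by rewrite e1 e2 e3 !addr0 scaler0; apply; perm_lia pw.
Qed.

Lemma phi_count x : (2 < count_mem x w0)%N -> phi w0 = 0.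
Proof.
have split w n : (n < count_mem x w)%N ->
    exists p q, w = p ++ x :: q /\ (n <= count_mem x q)%N.
  elim: w n => //= b w IH n; case: eqVneq => [->|bx] /=.
    by rewrite add1n ltnS => nw; exists [::], w.
  by rewrite add0n => /IH [p [q [-> nq]]]; exists (b :: p), q.
case/split=> p [q0 [e0 /split [w [q1 [e1 /split [w' [q [e2 _]]]]]]]].
by rewrite e0 e1 e2; apply: phi_triple; rewrite -e2 -e1 -e0.
Qed.

End TripleLetter.

(** * Values of commutative monomials *)

Section Monomials.
Variables (K : fieldType) (A : comNAAlgType K) (X : choiceType) (g : X -> A).
Implicit Types (s t : btree X) (m : cmon X).

Fixpoint tev t : A := match t with Leaf x => g x | Node l r => tev l ** tev r end.

Lemma tev_comm s t : comm_eqb s t -> tev s = tev t.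
Proof.
elim: s t => [x|a IHa b IHb] [y|c d] //=; first by move/eqP->.
by case/orP=> /andP[/IHa -> /IHb ->] //; rewrite namulC.
Qed.

Definition cev m : A := tev (repr m).

Lemma cev_pi t : cev (\pi_(cmon X) t)%qT = tev t.
Proof. exact/tev_comm/comm_eqb_repr. Qed.

Lemma cev_mul m1 m2 : cev (cmmul m1 m2) = cev m1 ** cev m2.
Proof. exact: cev_pi. Qed.

End Monomials.

Lemma cmdeg_mul (X : choiceType) (m1 m2 : cmon X) :
  cmdeg (cmmul m1 m2) = (cmdeg m1 + cmdeg m2)%N.
Proof. exact: cmdegE. Qed.

Lemma leaves_gt0 T (t : btree T) : (0 < leaves t)%N.
Proof. by elim: t => //= l hl r _; rewrite addn_gt0 hl. Qed.

Lemma size_le_dim_lt k n c (w : seq (cmon 'I_k)) :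
  all (fun m => cmdeg m < n)%N w -> (forall m, count_mem m w <= c)%N ->
  (size w <= c * dim_lt n k)%N.
Proof.
move=> /allP wn wc.
have sz : (size (undup w) <= dim_lt n k)%N.
  apply: uniq_leq_size (undup_uniq w) _ => m; rewrite mem_undup => /wn mn.
  rewrite in_fset_set; last exact: finite_cmdeg_lt.
  exact: mem_set.
apply: leq_trans (leq_mul (leqnn c) sz).
have -> : size w = (\sum_(m <- undup w) count_mem m w)%N.
  rewrite -sum1_size -big_undup_iterop_count; apply: eq_bigr => m _.
  by rewrite Monoid.iteropE iter_addn_0 mul1n.
rewrite -[(c * _)%N]addn0 -iter_addn -count_predT -big_const_seq.
exact: leq_sum.
Qed.

(** * Vanishing of heavy words on the cube ideal *)

Section WordRewriting.
Variables (K : fieldType) (A : comNAAlgType K) (gamma : K) (k n : nat).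
Hypotheses (two0 : 2 != 0 :> K) (three0 : 3 != 0 :> K).
Hypotheses (gamma0 : gamma != 0) (gammaN1 : gamma + 1 != 0).
Hypotheses (gamma1 : 1 - gamma != 0) (delta0 : 2 * gamma - 1 != 0).
Hypothesis LA : Lcube_identity A gamma.
Variable g : 'I_k -> A.
Hypothesis high_degree : forall m, (n <= cmdeg m)%N -> cube_span (cev g m).

(** Total degree, which stays the same when neighbouring letters are merged into their product. *)
Definition weight (X : choiceType) (w : seq (cmon X)) := sumn (map (@cmdeg X) w).

Lemma weight_cat (X : choiceType) (p q : seq (cmon X)) :
  weight (p ++ q) = (weight p + weight q)%N.
Proof. by rewrite /weight map_cat sumn_cat. Qed.

Lemma perm_weight (X : choiceType) (p q : seq (cmon X)) :
  perm_eq p q -> weight p = weight q.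
Proof. by move=> pq; apply/perm_sumn/perm_map. Qed.

Lemma weight_le (X : choiceType) (w : seq (cmon X)) d :
  all (fun m => cmdeg m <= d)%N w -> (weight w <= d * size w)%N.
Proof.
elim: w => [|m w IH] //= /andP[md /IH wd]; rewrite mulnS /weight /=.
exact: leq_add.
Qed.

Lemma act_cube_span w v : cube_span v -> cube_span (act (cev g) w v).
Proof.
move=> Cv; elim: w => //= m w.
exact: (cube_span_mulr two0 three0 gamma0 gammaN1 LA).
Qed.

(** Induction on the length, since merging letters shortens a word at equal weight. A word with no
    letter of degree at least [n] and no triple letter is too short for its weight. *)
Lemma act_high_weight w v : cube_span v ->
  (2 * dim_lt n k * n.-1 < weight w)%N -> act (cev g) w v = 0.
Proof.
move=> Cv; have [s] := ubnP (size w); elim: s w => // s IH w sw ww.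
have [/allP wn|] := boolP (all (fun m => cmdeg m < n)%N w); last first.
  case/allPn=> m /splitPr[p q]; rewrite -leqNgt => nm.
  rewrite act_cat /= (cube_span_mul0 two0 three0 gamma0 gammaN1 delta0 LA) ?act0 //.
    exact: high_degree.
  exact: act_cube_span.
have [[m cm]|cw] := pselect (exists m, 2 < count_mem m w)%N; last first.
  have szw : (size w <= 2 * dim_lt n k)%N.
    apply: size_le_dim_lt => [|m]; first exact/allP.
    by rewrite leqNgt; apply/negP => cm; apply: cw; exists m.
  move: ww; rewrite ltnNge => /negP[]; rewrite mulnC.
  apply: leq_trans (weight_le (d := n.-1) _) (leq_mul (leqnn _) szw).
  by apply/allP => m /wn; case: (n).
(* Both are words with merged letters, so the induction hypothesis kills them. *)
have short p q x y z : perm_eq (p ++ x :: y :: z :: q) w ->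
    act (cev g) p (cev g z ** (cev g x ** cev g y ** act (cev g) q v)) = 0 /\
    act (cev g) p (cev g x ** (cev g y ** cev g z) ** act (cev g) q v) = 0.
  move=> pw; have := perm_size pw; have := perm_weight pw.
  rewrite size_cat weight_cat /weight /= => wp sp.
  have := IH (p ++ z :: cmmul x y :: q); have := IH (p ++ cmmul x (cmmul y z) :: q).
  rewrite !act_cat !size_cat !weight_cat /weight /= !cev_mul !cmdeg_mul => IH1 IH2.
  by split; [apply: IH2 | apply: IH1]; move: sw ww; rewrite /weight -sp -wp; lia.
have mid p q x y a : perm_eq (p ++ x :: a :: y :: q) w ->
    act (cev g) (p ++ x :: a :: y :: q) v + act (cev g) (p ++ y :: a :: x :: q) v =
    (2 * gamma - 1) *: (act (cev g) (p ++ a :: x :: y :: q) v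
                        + act (cev g) (p ++ a :: y :: x :: q) v).
  move=> pw; rewrite !act_cat /=.
  have [e1 _] : _ /\ _ := short p q x y a ltac:(perm_lia pw).
  have [_ e2] : _ /\ _ := short p q a x y ltac:(perm_lia pw).
  have := congr1 (act (cev g) p) (Lsq_polar two0 gammaN1 LA (cev g x) (cev g y)
    (act (cev g) q v) (cev g a)).
  rewrite /ctri !(namulC (act (cev g) q v)) !namulE !(actD, actZ) e1 e2.
  by rewrite !addr0.
(* Up to merged words, the side relation is [Lcube_polar] minus [mid], as - 1 - delta = - 2
   gamma. *)
apply: (@phi_count K A _ gamma (fun w => act (cev g) w v)) cm => // p q x y a pw.
have [_ e1] : _ /\ _ := short p q x y a ltac:(perm_lia pw).
have [_ e2] : _ /\ _ := short p q y x a ltac:(perm_lia pw).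
have [_ e3] : _ /\ _ := short p q a x y ltac:(perm_lia pw).
have := congr1 (act (cev g) p) (Lcube_polar LA (cev g x) (cev g y)
  (cev g a) (act (cev g) q v)).
have := mid p q x y a ltac:(perm_lia pw).
rewrite !act_cat /= /ctri !(namulC (act (cev g) q v)) !namulE !(actD, actZ) e1 e2 e3.
move=> h1 h2; apply: (lincomb (k := 1) h2); apply: (lincomb (k := -1) h1); module.
Qed.

End WordRewriting.

(** * Algebras in which all cubes vanish *)

Section NilIndexThree.
Variables (K : fieldType) (A : comNAAlgType K).
Hypothesis two0 : 2 != 0 :> K.
Hypothesis cube0 : forall x : A, cube x = 0.
Implicit Types (a b c u v x : A).

Lemma ctri0 a b c : ctri a b c = 0.
Proof.
by apply: (scalerI two0); rewrite scaler0 ctri_cube !cube0 !subr0 !addr0.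
Qed.

Lemma namul_namul a b u : (a ** b) ** u = - (a ** (b ** u) + b ** (a ** u)).
Proof.
by apply: (lincomb (k := 1) (ctri0 a b u)); rewrite /ctri (namulC u); module.
Qed.

(** [ctri a b c] acts as zero, and [namul_namul] turns its action into twice this sum. *)
Lemma LLL_sym a b c u :
  a ** (b ** (c ** u)) + a ** (c ** (b ** u)) + b ** (a ** (c ** u))
  + b ** (c ** (a ** u)) + c ** (a ** (b ** u)) + c ** (b ** (a ** u)) = 0.
Proof.
apply: (scalerI two0); rewrite scaler0.
have := congr1 (fun z => z ** u) (ctri0 a b c).
rewrite /ctri !namulDl namul0l !namul_namul !(namulrN, namulDr) => e.
by apply: (lincomb (k := 1) e); module.
Qed.

(** Expanding [cube x ** u] gives the coefficient 4; equal letters in [LLL_sym] would give 6 and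
    call for an invertible 3. *)
Lemma LLL0 x u : x ** (x ** (x ** u)) = 0.
Proof.
apply: (scalerI (expf_neq0 2 two0)); rewrite scaler0.
have := congr1 (fun z => z ** u) (cube0 x).
rewrite /cube namul0l !namul_namul !(namulrN, namulDr) => e.
by apply: (lincomb (k := 1) e); module.
Qed.

(** * Adjoining one generator *)

Section AdjoinGenerator.
Variables (k n : nat) (g : 'I_k -> A) (x : A).
Hypothesis high_degree : forall m, (n <= cmdeg m)%N -> cev g m = 0.
Local Notation letter := (option (cmon 'I_k)).

(** [None] is the new generator, which is never merged with other letters. *)
Definition oev (l : letter) : A := if l is Some m then cev g m else x.
Definition odeg (l : letter) : nat := if l is Some m then cmdeg m else 1%N.
Definition oweight (w : seq letter) : nat := sumn (map odeg w).

Section FixedLetters.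
Variables (v : A) (w0 : seq letter).
Implicit Types (m : cmon 'I_k) (p q w : seq letter).
Local Notation phi w := (act oev w v).
Hypothesis merge : forall p q m m',
  perm_eq (p ++ Some m :: Some m' :: q) w0 -> phi (p ++ Some (cmmul m m') :: q) = 0.

Lemma phi_anti p q m m' : perm_eq (p ++ Some m :: Some m' :: q) w0 ->
  phi (p ++ Some m :: Some m' :: q) = - phi (p ++ Some m' :: Some m :: q).
Proof.
move=> /merge; rewrite !act_cat /= cev_mul namul_namul actN actD => e.
by apply: (lincomb (k := -1) e); module.
Qed.

(** In [LLL_sym] for [m], [x], [m'] the words with [m] and [m'] adjacent cancel in pairs. *)
Lemma phi_anti1 p q m m' : perm_eq (p ++ Some m :: None :: Some m' :: q) w0 ->
  phi (p ++ Some m :: None :: Some m' :: q) =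
  - phi (p ++ Some m' :: None :: Some m :: q).
Proof.
move=> pw.
have := @phi_anti (rcons p None) q m m'; rewrite !cat_rcons => e1.
have {}e1 := e1 ltac:(perm_lia pw).
have e2 := @phi_anti p (None :: q) m m' ltac:(perm_lia pw).
move: e1 e2; rewrite !act_cat /= => e1 e2.
have := congr1 (act oev p) (LLL_sym (cev g m) x (cev g m') (act oev q v)).
rewrite !actD act0 => e3; apply: (lincomb (k := 1) e3).
by apply: (lincomb (k := -1) e1); apply: (lincomb (k := -1) e2); module.
Qed.

(** Add [LLL_sym] for [x], [x], [m] acting on [m'] and the same with [m], [m'] exchanged; the words
    with a leading [x] cancel by [phi_anti] and [phi_anti1]. *)
Lemma phi_anti2 p q m m' :
  perm_eq (p ++ Some m :: None :: None :: Some m' :: q) w0 ->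
  phi (p ++ Some m :: None :: None :: Some m' :: q) =
  - phi (p ++ Some m' :: None :: None :: Some m :: q).
Proof.
move=> pw.
have := @phi_anti (rcons (rcons p None) None) q m m'; rewrite !cat_rcons => e1.
have {}e1 := e1 ltac:(perm_lia pw).
have := @phi_anti1 (rcons p None) q m m'; rewrite !cat_rcons => e2.
have {}e2 := e2 ltac:(perm_lia pw).
move: e1 e2; rewrite !act_cat /= => e1 e2.
have := congr1 (act oev p) (LLL_sym x x (cev g m) (cev g m' ** act oev q v)).
have := congr1 (act oev p) (LLL_sym x x (cev g m') (cev g m ** act oev q v)).
rewrite !actD !act0 => e3 e4; apply: (scalerI two0).
apply: (lincomb (k := 1) e3); apply: (lincomb (k := 1) e4).
by apply: (lincomb (k := -2) e1); apply: (lincomb (k := -2) e2); module.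
Qed.

Lemma phi_NNN p q : phi (p ++ None :: None :: None :: q) = 0.
Proof. by rewrite act_cat /= LLL0 act0. Qed.

(** The left copy moves right, changing sign at each swap with the next letter other than [x]; at
    the right copy the word equals its own opposite. Gaps of at most two [x] suffice, because three
    in a row give zero. *)
Lemma phi_repeat w p q m : perm_eq (p ++ Some m :: w ++ Some m :: q) w0 ->
  phi (p ++ Some m :: w ++ Some m :: q) = 0.
Proof.
have [s] := ubnP (size w); elim: s w p => // s IH w p sw pw.
have self0 (z : A) : z = - z -> z = 0.
  by move=> e; apply: (scalerI two0); apply: (lincomb (k := 1) e); module.
case: w sw pw => [|[m1|] w] sw pw.
- by apply: self0; rewrite {1}phi_anti.
- rewrite [LHS]phi_anti //; have := IH w (rcons p (Some m1)); rewrite !cat_rcons.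
  by move=> ->; rewrite ?oppr0 //; perm_lia pw.
case: w sw pw => [|[m1|] w] sw pw.
- by apply: self0; rewrite {1}phi_anti1.
- rewrite [LHS]phi_anti1 //.
  have := IH w (rcons (rcons p (Some m1)) None); rewrite !cat_rcons.
  by move=> ->; rewrite ?oppr0 //; [exact: ltnW | perm_lia pw].
case: w sw pw => [|[m1|] w] sw pw.
- by apply: self0; rewrite {1}phi_anti2.
- rewrite [LHS]phi_anti2 //.
  have := IH w (rcons (rcons (rcons p (Some m1)) None) None); rewrite !cat_rcons.
  by move=> ->; rewrite ?oppr0 //; [exact/ltnW/ltnW | perm_lia pw].
by have := phi_NNN (rcons p (Some m)) (w ++ Some m :: q); rewrite cat_rcons.
Qed.

End FixedLetters.

(** Otherwise at most two [None] precede each [Some] or follow the last one; the recursion cuts off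
    blocks of at most three letters. *)
Lemma NNN_factor (w : seq letter) : (3 * (count isSome w).+1 <= size w)%N ->
  exists p q, w = p ++ None :: None :: None :: q.
Proof.
have [s] := ubnP (size w); elim: s w => // s IH w sw.
have cons_case (p w' : seq letter) : w = p ++ w' -> (0 < size p <= 3)%N ->
    (0 < count isSome p)%N -> (3 * (count isSome w).+1 <= size w)%N ->
    exists p q, w = p ++ None :: None :: None :: q.
  move=> e /andP[p0 p3] cp; move: sw; rewrite e size_cat count_cat => sw cw.
  have IHp : exists p' q, w' = p' ++ None :: None :: None :: q.
    apply: IH.
      lia.
    lia.
  have [p' [q ->]] := IHp.
  by exists (p ++ p'), q; rewrite catA.
case: w sw cons_case => [|[m|] w] //= sw cc cw.
  exact: (cc [:: Some m] w).
case: w sw cc cw => [|[m|] w] //= sw cc cw.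
  exact: (cc [:: None; Some m] w).
case: w sw cc cw => [|[m|] w] //= sw cc cw.
  exact: (cc [:: None; None; Some m] w).
by exists [::], w.
Qed.

(** Induction on the number of [Some] letters, which a merge lowers at equal weight. Without
    repetition there are at most [dim_lt n.+1 k] of them, and the weight, at most [n] per letter,
    forces three [None] in a row. *)
Lemma act_heavy w v : (3 * n * (dim_lt n.+1 k).+1 <= oweight w)%N -> (0 < n)%N ->
  act oev w v = 0.
Proof.
move=> ww n0.
have [s] := ubnP (count isSome w); elim: s w ww v => // s IH w ww v sw.
(* The threshold [n.+1] admits [None], of degree 1, as soon as [0 < n]. *)
have [/allP wn|] := boolP (all (fun l => odeg l < n.+1)%N w); last first.
  case/allPn=> -[m|] /splitPr[p q]; rewrite -leqNgt /= => nm; last lia.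
  by rewrite act_cat /= high_degree ?namul0l ?act0 // ltnW.
have [[m cm]|cw] := pselect (exists m, 1 < count_mem (Some m) w)%N.
  have split r j : (j < count_mem (Some m) r)%N -> exists p q : seq letter,
      r = p ++ Some m :: q /\ (j <= count_mem (Some m) q)%N.
    elim: r j => //= l r IHr j; case: eqVneq => [->|lm] /=.
      by rewrite add1n ltnS => jr; exists [::], r.
    by rewrite add0n => /IHr [p [q [-> jq]]]; exists (l :: p), q.
  case/split: cm => p [q1 [e0 /split [w' [q [e1 _]]]]].
  rewrite e0 e1; apply: (phi_repeat (w0 := w)); last by rewrite e0 e1.
  move=> p' q' m1 m2 pw.
  have := permP pw isSome; have := perm_sumn (perm_map odeg pw).
  rewrite !map_cat !sumn_cat !count_cat /= => wp cp.
  apply: IH; rewrite /oweight ?map_cat ?sumn_cat ?count_cat /= ?cmdeg_mul.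
    by move: ww; rewrite /oweight -wp !addnA.
  by move: sw; rewrite -cp; lia.
have [p [q ->]] : exists p q, w = p ++ None :: None :: None :: q.
  apply: NNN_factor; have some_le : (count isSome w <= 1 * dim_lt n.+1 k)%N.
    rewrite -(size_pmap id); apply: size_le_dim_lt => [|m].
      apply/allP => m; rewrite mem_pmap => /mapP[l lw ml].
      by rewrite (wn (Some m)) // ml.
    suff -> : count_mem m (pmap id w) = count_mem (Some m) w.
      by rewrite leqNgt; apply/negP => cm; apply: cw; exists m.
    by elim: (w) => //= -[m'|] r /= ->.
  have ww' : (oweight w <= n * size w)%N.
    elim: (w) wn => [|l r IHr] //= wn; rewrite mulnS leq_add //.
      by apply: wn; rewrite inE eqxx.
    by apply: IHr => l' lr; apply: wn; rewrite inE lr orbT.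
  have := leq_trans ww ww'; rewrite (mulnC 3) -mulnA leq_pmul2l //; lia.
exact: phi_NNN.
Qed.

End AdjoinGenerator.

(** [namul_namul] replaces a product letter by its two factors, in either order; [mu] counts the
    [Node] constructors left. *)
Lemma act_trees k (g : 'I_k -> A) M (ts : seq (btree 'I_k)) v :
  (forall (w : seq 'I_k) v, (M <= size w)%N -> act g w v = 0) ->
  (M <= sumn (map (@leaves _) ts))%N -> act (tev g) ts v = 0.
Proof.
move=> gM; pose mu := sumn (map (fun t : btree 'I_k => (leaves t).-1) ts).
have [s] := ubnP mu; rewrite {}/mu; elim: s ts v => // s IH ts v sts Mts.
have [[p [l [r [q ets]]]]|noNode] :=
    pselect (exists p l r q, ts = p ++ Node l r :: q).
  move: sts Mts; rewrite ets !map_cat !sumn_cat /= => sts Mts.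
  have [l0 r0] := (leaves_gt0 l, leaves_gt0 r).
  have e1 := IH (p ++ l :: r :: q) v; have e2 := IH (p ++ r :: l :: q) v.
  move: e1 e2; rewrite !map_cat !sumn_cat !act_cat /= => e1 e2.
  rewrite namul_namul actN actD e1 ?e2 ?addr0 ?oppr0 //; lia.
have [w ew] : exists w, ts = map (@Leaf _) w.
  elim: (ts) noNode => [|t r IHr] noNode; first by exists [::].
  have [|w ->] := IHr.
    by case=> p [l [r' [q er]]]; apply: noNode; exists (t :: p), l, r', q; rewrite er.
  case: t noNode => [i|l r'] noNode; first by exists (i :: w).
  by case: noNode; exists [::], l, r', r.
have -> : act (tev g) ts v = act g w v by rewrite ew; elim: (w) => //= i r ->.
apply: gM; rewrite (leq_trans Mts) // ew -map_comp.
by elim: (w) => //= i r; rewrite add1n ltnS.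
Qed.

(** One of the two factors has at least [M] leaves, and its operator kills the other. *)
Lemma tev_heavy k (g : 'I_k -> A) M (t : btree 'I_k) :
  (forall (w : seq 'I_k) v, (M <= size w)%N -> act g w v = 0) ->
  (2 * M < leaves t)%N -> tev g t = 0.
Proof.
case: t => [i|l r] gM /= lt.
  (* A single generator is heavy only for [M = 0], and then the empty word already vanishes. *)
  have /(gM [::]) : (M <= size (Nil 'I_k))%N by case: M gM lt.
  exact.
have [lM|Ml] := leqP M (leaves l).
  by apply: (act_trees (ts := [:: l]) _ gM); rewrite /= addn0.
rewrite namulC; apply: (act_trees (ts := [:: r]) _ gM); rewrite /= addn0; lia.
Qed.

Lemma nil_words k (g : 'I_k -> A) : exists M, forall (w : seq 'I_k) v,
  (M <= size w)%N -> act g w v = 0.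
Proof.
elim: k g => [|k IHk] g; first by exists 1%N => -[|[]].
have [M gM] := IHk (fun i => g (lift ord_max i)).
(* By [tev_heavy], monomials of degree at least [n] in the other generators vanish. *)
pose n := (2 * M).+1; exists (3 * n * (dim_lt n.+1 k).+1)%N => w v sw.
pose f i := omap (fun j => \pi_(cmon 'I_k)%qT (Leaf j)) (unlift ord_max i).
have <- : act (oev (fun i => g (lift ord_max i)) (g ord_max)) (map f w) v = act g w v.
  elim: (w) => //= i r ->; rewrite /f; case: unliftP => [j|] -> //=.
  by rewrite cev_pi.
apply: (act_heavy (n := n)) => // [m nm|]; first exact: tev_heavy gM nm.
apply: leq_trans sw _; rewrite leq_eqVlt; apply/orP; left; apply/eqP.
rewrite /oweight; elim: (w) => //= i r ->; rewrite /f.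
by case: unliftP => [j|] _ //=; rewrite cmdegE.
Qed.

Lemma nil_monomials k (g : 'I_k -> A) : exists N, forall t : btree 'I_k,
  (N <= leaves t)%N -> tev g t = 0.
Proof.
by have [M gM] := nil_words g; exists (2 * M).+1 => t; apply: tev_heavy gM.
Qed.

End NilIndexThree.

(** * Spans of products of many generators *)

Section GeneratedSpan.
Variables (K : fieldType) (A : comNAAlgType K) (k : nat) (g : 'I_k -> A).
Implicit Types (x y : A) (t : btree 'I_k).

Definition gspan (w : nat) : set A :=
  lspan [set x | exists2 t, (w <= leaves t)%N & x = tev g t].

Lemma gspan_tev w t : (w <= leaves t)%N -> gspan w (tev g t).
Proof. by move=> wt; apply: sub_lspan; exists t. Qed.

Lemma gspan_mul w w' x y : gspan w x -> gspan w' y -> gspan (w + w') (x ** y).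
Proof.
apply: lspan_mul => _ _ [t wt ->] [t' wt' ->].
by apply: (gspan_tev (t := Node t t')); rewrite /= leq_add.
Qed.

Lemma gspan_le w w' : (w <= w')%N -> (gspan w' `<=` gspan w)%classic.
Proof.
move=> ww; apply: lspan_sub => _ [t wt ->].
by exists t => //; apply: leq_trans wt.
Qed.

Lemma subalgebra_gen_gspan : (subalgebra_gen (range g) `<=` gspan 1)%classic.
Proof.
move=> x; apply; split; last by move=> _ [i _ <-]; apply: (gspan_tev (t := Leaf i)).
split; [exact: LSpan0 | exact: lspan_comb | move=> u v gu gv].
exact: (gspan_le (w' := 2)) (gspan_mul gu gv).
Qed.

Lemma tprod_gspan (s : btree A) :
  leaves_in (gspan 1) s -> gspan (leaves s) (tprod s).
Proof. by elim: s => //= l IHl r IHr [/IHl gl /IHr gr]; apply: gspan_mul. Qed.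

End GeneratedSpan.

(** * The homomorphism out of the free commutative algebra *)

Section FreeHom.
Variables (K : fieldType) (A : comNAAlgType K) (k : nat) (g : 'I_k -> A).
Local Notation F := (freeCom K 'I_k).

Definition freeHom (f : F) : A := \sum_(m <- msupp f) f@_m *: cev g m.

Lemma freeHomw (d : {fset cmon 'I_k}) f : (msupp f `<=` d)%fset ->
  freeHom f = \sum_(m <- d) f@_m *: cev g m.
Proof.
move=> fd; apply: big_fset_incl => // m _ /mcoeff_outdom ->; exact: scale0r.
Qed.

Lemma freeHom_comb (c : K) f f' : freeHom (c *: f + f') = c *: freeHom f + freeHom f'.
Proof.
pose d := (msupp f `|` msupp f')%fset.
have fd : (msupp f `<=` d)%fset by exact: fsubsetUl.
rewrite (@freeHomw d (_ + _)); last first.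
  apply: fsubset_trans (msuppD_le _ _) _; apply: fsetSU; exact: msuppZ_le.
rewrite (freeHomw fd) (@freeHomw d f') ?fsubsetUr // scaler_sumr -big_split /=.
by apply: eq_bigr => m _; rewrite mcoeffD mcoeffZ scalerDl scalerA.
Qed.

Lemma freeHom0 : freeHom 0 = 0.
Proof. by rewrite /freeHom msupp0 big_seq_fset0. Qed.

Lemma freeHomU c m : freeHom << c *g m >> = c *: cev g m.
Proof. by rewrite (freeHomw msuppU_le) big_seq_fset1 mcoeffUU. Qed.

Lemma freeHomM f f' : freeHom (f ** f') = freeHom f ** freeHom f'.
Proof.
have freeHomD : {morph freeHom : u v / u + v}.
  by move=> u v; rewrite -[u]scale1r freeHom_comb !scale1r.
have -> : f ** f' = fcmul f f' by [].
rewrite /fcmul (big_morph _ freeHomD freeHom0) [freeHom f]/freeHom.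
rewrite (big_morph _ (fun a b => namulDl a b (freeHom f')) (namul0l _)).
apply: eq_bigr => m _; rewrite (big_morph _ freeHomD freeHom0) [freeHom f']/freeHom.
rewrite (big_morph _ (namulDr _) (namul0r _)); apply: eq_bigr => m' _.
by rewrite freeHomU cev_mul namulZl namulZr scalerA.
Qed.

(** The preimage of the cube ideal is an ideal containing all cubes. *)
Lemma freeHom_cube_ideal f : is_ideal (@cube_span K A) ->
  ideal_gen (range (@cube K F)) f -> cube_span (freeHom f).
Proof.
move=> [C0 CD CM] If; apply: (If [set u | cube_span (freeHom u)]%classic); split.
  split=> [|c u v Cu Cv|u v Cv] /=; first by rewrite freeHom0.
    by rewrite freeHom_comb; apply: CD.
  by rewrite freeHomM; apply: CM.
by move=> _ [u _ <-] /=; rewrite /cube !freeHomM; apply: cube_span_cube.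
Qed.

End FreeHom.

Lemma freeComU (K : fieldType) (X : choiceType) (c : K) (m : cmon X) :
  << c *g m >> = c *: (<< 1 *g m >> : freeCom K X).
Proof.
apply/malgP => j; rewrite mcoeffZ; apply: etrans (@mcoeffU (cmon X) K m c j) _.
transitivity (c * (1 *+ (m == j))); first by rewrite mulrnAr mulr1.
by congr (_ * _); apply/esym; exact: (@mcoeffU (cmon X) K m 1 j).
Qed.

(** * Nilpotency of the free algebra with zero cubes *)

Section FreeNil3.
Variables (K : fieldType) (k : nat).
Hypothesis two0 : 2 != 0 :> K.
Local Notation F := (freeCom K 'I_k).
Local Notation Q := (freeComNil3 K k).
Local Notation cubes := (range (@cube K F)).
Local Notation pi := (\pi_(quotAlg cubes))%qT.

Definition nil3_gen (i : 'I_k) : Q := pi (<< 1 *g \pi_(cmon 'I_k)%qT (Leaf i) >> : F).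

Lemma nil3_gen_tev t : tev nil3_gen t = pi (<< 1 *g \pi_(cmon 'I_k)%qT t >> : F).
Proof.
elim: t => [i|l IHl r IHr]; first reflexivity.
transitivity (tev nil3_gen l ** tev nil3_gen r); first reflexivity.
rewrite IHl IHr.
have e := @freeCom_mulUU K _ 1 1 (\pi_(cmon 'I_k)%qT l) (\pi_(cmon 'I_k)%qT r).
rewrite mul1r cmmulE in e; rewrite -e; exact: (qmulE cubes).
Qed.

Lemma nil3_gspan (u : Q) : gspan nil3_gen 1 u.
Proof.
rewrite -[u]reprK; move: (repr u) => {u} f.
have fE := monalgE f; rewrite fE.
elim: (msupp f : seq _) => [|m r IHr].
  by rewrite big_nil; exact: LSpan0.
have piD (a b : F) : pi (a + b) = pi a + pi b by exact/esym/qaddE.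
have piZ (c : K) (a : F) : pi (c *: a) = c *: pi a by exact/esym/qscaleE.
rewrite big_cons piD.
apply: lspanD; last exact: IHr.
have e := freeComU (f@_m) m.
have em : pi (<< 1 *g m >> : F) = tev nil3_gen (repr m) by rewrite nil3_gen_tev reprK.
have -> : pi << f@_m *g m >> = f@_m *: tev nil3_gen (repr m) by rewrite -em -piZ -e.
apply: lspanZ; apply: gspan_tev; exact: leaves_gt0.
Qed.

Lemma nil3_nilpotent : exists N, nilpotent_upto [set: Q]%classic N.
Proof.
have [N gN] := nil_monomials two0 (@freeComNil3_cube K k) nil3_gen.
exists N => t _ Nt; have gt : leaves_in (gspan nil3_gen 1) t.
  by elim: t {Nt} => [u|l IHl r IHr]; [exact: nil3_gspan | split].
apply: lspan_set0 (gspan_le Nt (tprod_gspan gt)).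
by move=> _ [s Ns ->]; apply: gN.
Qed.

Lemma nil3_nilpotency_index : exists n, nilpotency_index [set: Q]%classic n.
Proof.
have [N QN] := nil3_nilpotent.
have ex : exists n, `[< nilpotent_upto [set: Q]%classic n >].
  by exists N; apply/asboolP.
exists (ex_minn ex); case: ex_minnP => n /asboolP Qn min_n.
by split=> // m Qm; apply: min_n; apply/asboolP.
Qed.

(** Lifts vanishing in the quotient to the free algebra, from where [freeHom] carries it to other
    algebras. *)
Lemma nilpotent_ideal_gen n t : nilpotent_upto [set: Q]%classic n ->
  (n <= leaves t)%N -> ideal_gen cubes (<< 1 *g \pi_(cmon 'I_k)%qT t >> : F).
Proof.
move=> Qn nt; suff /eqP : pi (<< 1 *g \pi_(cmon 'I_k)%qT t >> : F) = pi 0.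
  by move/quotAlg_eqP; rewrite subr0.
rewrite -nil3_gen_tev.
have [s [ls es]] : exists s : btree Q, leaves s = leaves t /\ tprod s = tev nil3_gen t.
  elim: (t) => [i|l [s [ls es]] r [s' [ls' es']]]; first by exists (Leaf (nil3_gen i)).
  by exists (Node s s'); rewrite /= ls ls' es es'.
rewrite -es; apply: Qn; last by rewrite ls.
by elim: (s) => //= ? ? ? ?.
Qed.

End FreeNil3.

(** At each node one child keeps at least half of the leaves; descending into it yields [D] nested
    multiplications, whose effect [Q] records. *)
Lemma tprod_chain (K : fieldType) (A : comNAAlgType K) (B : set A)
    (Q : nat -> set A) : (B `<=` Q 0)%classic ->
  (forall x y, B x -> B y -> B (x ** y)) ->
  (forall j x y, B x -> Q j y -> Q j.+1 (x ** y)) ->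
  forall D t, leaves_in B t -> (2 ^ D <= leaves t)%N -> Q D (tprod t).
Proof.
move=> B0 BM BQ; have Bt t : leaves_in B t -> B (tprod t).
  by elim: t => //= l IHl r IHr [/IHl Bl /IHr Br]; apply: BM.
elim=> [|D IH] [x|l r]; rewrite ?expnS //=.
- by move=> Bx _; apply: B0.
- by case=> Bl Br _; apply: B0; apply: BM; apply: Bt.
- by have := expn_gt0 2 D; lia.
case=> Bl Br lr; have [lD|Dl] := leqP (2 ^ D) (leaves l).
  by rewrite namulC; apply: BQ; [exact: Bt | exact: IH].
by apply: BQ; [exact: Bt | apply: IH => //; lia].
Qed.

(** * The nilpotency bound *)

Section NilpotencyBound.
Variables (K : fieldType) (A : comNAAlgType K) (gamma : K) (k n : nat).
Hypotheses (two0 : 2 != 0 :> K) (three0 : 3 != 0 :> K).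
Hypotheses (gamma0 : gamma != 0) (gammaN1 : gamma + 1 != 0).
Hypotheses (gamma1 : 1 - gamma != 0) (delta0 : 2 * gamma - 1 != 0).
Hypothesis LA : Lcube_identity A gamma.
Hypothesis Qn : nilpotent_upto [set: freeComNil3 K k]%classic n.
Variable g : 'I_k -> A.

Lemma cube_span_ideal : is_ideal (@cube_span K A).
Proof.
split; [exact: LSpan0 | exact: lspan_comb |].
by move=> x y; apply: (cube_span_mulr two0 three0 gamma0 gammaN1 LA).
Qed.

Lemma tev_cube_span t : (n <= leaves t)%N -> cube_span (tev g t).
Proof.
move=> /(nilpotent_ideal_gen Qn) /(freeHom_cube_ideal g cube_span_ideal).
by rewrite freeHomU scale1r cev_pi.
Qed.

Lemma gspan_nilpotent : (1 < n)%N -> (0 < k)%N ->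
  nilpotent_upto (gspan g 1) (2 ^ (4 * n * dim_lt n k + 2 * (n - 2))).
Proof.
move=> n1 k0.
(* A generator has degree 1, below [n]; the arithmetic at the end relies on this. *)
have dim0 : (0 < dim_lt n k)%N.
  have := @size_le_dim_lt k n 1 [:: \pi_(cmon 'I_k)%qT (Leaf (Ordinal k0))].
  by rewrite mul1n /= cmdegE /= n1; apply=> // m; case: eqP.
pose J m : set A := lspan [set x | exists w v, [/\ cube_span v, (m <= weight w)%N
  & x = act (cev g) w v]].
(* The first [n - 2] multiplications raise the degree, the next one reaches degree [n] and so the
   cube ideal, and each later one adds a letter of weight at least 1. *)
pose Q j : set A := if (j < n.-1)%N then gspan g j.+1 else J (j - n.-1)%N.
have QS j x y : gspan g 1 x -> Q j y -> Q j.+1 (x ** y).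
  rewrite /Q => gx; case: ltnP => jn; case: ltnP => jn'.
  - by move=> gy; rewrite -[j.+2]add1n; apply: gspan_mul.
  - move=> gy; have {gy} := gspan_mul gx gy.
    apply: lspan_min; [exact: LSpan0 | exact: lspan_comb |].
    move=> _ [t nt ->]; apply: sub_lspan; exists [::], (tev g t).
    by split=> //; [apply: tev_cube_span; lia | rewrite /weight /=; lia].
  - lia.
  - apply: lspan_mul gx => _ _ [t t1 ->] [w [v [Cv jw ->]]].
    apply: sub_lspan; exists (\pi_(cmon 'I_k)%qT t :: w), v.
    by split=> //=; rewrite ?cev_pi // /weight /= cmdegE; move: jw; rewrite /weight; lia.
move=> t gt Dt; have : Q (4 * n * dim_lt n k + 2 * (n - 2))%N (tprod t).
  apply: (tprod_chain (B := gspan g 1)) gt Dt => //.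
    by move=> x gx; rewrite /Q; case: ltnP => //; lia.
  by move=> x y gx gy; apply: (gspan_le (w' := 2)) (gspan_mul gx gy).
rewrite /Q ifF; last by nia.
apply: lspan_set0 => _ [w [v [Cv jw ->]]].
apply: (act_high_weight two0 three0 gamma0 gammaN1 gamma1 delta0 LA (n := n)) => //.
  by move=> m nm; rewrite -[m]reprK cev_pi; apply: tev_cube_span.
(* After the first [n.-1] multiplications more than [2 * dim_lt n k * n.-1] remain. *)
by apply: leq_trans jw; nia.
Qed.

(** For such [n] the exponent is 0 and the bound 1, so the algebra must be zero. Its generators lie
    in the cube ideal, which is then everything and has square zero, while a cube is a product. *)
Lemma low_index_trivial : (n <= 1)%N -> subalgebra_gen (range g) = setT ->
  forall x : A, x = 0.
Proof.
move=> n1 gA; have all_cubes (x : A) : cube_span x.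
  have : subalgebra_gen (range g) x by rewrite gA.
  have [C0 CD CM] := cube_span_ideal; apply; split.
    by split=> // u v _; apply: CM.
  by move=> _ [i _ <-]; apply: (tev_cube_span (t := Leaf i)).
move=> x; apply: lspan_set0 (all_cubes x) => _ [y _ <-].
exact: (cube_span_mul0 two0 three0 gamma0 gammaN1 delta0 LA).
Qed.

End NilpotencyBound.

Lemma nilpotent_upto_le (K : fieldType) (A : comNAAlgType K) (B : set A) m n :
  (m <= n)%N -> nilpotent_upto B m -> nilpotent_upto B n.
Proof. by move=> mn Bm t Bt nt; apply: Bm => //; apply: leq_trans nt. Qed.

Lemma nilpotent_upto_sub (K : fieldType) (A : comNAAlgType K) (B C : set A) n :
  (B `<=` C)%classic -> nilpotent_upto C n -> nilpotent_upto B n.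
Proof.
move=> BC Cn t Bt; apply: Cn; elim: t Bt => [x /BC//|l IHl r IHr [/IHl + /IHr]].
by split.
Qed.

Theorem theorem3 (K : fieldType) (gamma : K)
    (char_neq2 : 2%N \notin [pchar K]) (char_neq3 : 3%N \notin [pchar K])
    (gamma_neq0 : gamma != 0)
    (gamma_neq1 : gamma != 1) (gamma_neqN1 : gamma != -1)
    (gamma_neqV2 : gamma != 2^-1) (gamma_neqNV2 : gamma != - 2^-1) :
  (forall A : comNAAlgType K, Lcube_identity A gamma -> locally_nilpotent A) /\
  (forall k : nat, (1 <= k)%N ->
     exists n : nat,
       nilpotency_index [set: freeComNil3 K k]%classic n /\
       forall A : comNAAlgType K,
         generated_by A k -> Lcube_identity A gamma ->
         nilpotent_upto [set: A]%classic
           (2 ^ (4 * n * dim_lt n k + 2 * (n - 2)))%N).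
Proof.
have two0 : 2 != 0 :> K by move: char_neq2; rewrite inE.
have three0 : 3 != 0 :> K by move: char_neq3; rewrite inE.
have gammaN1 : gamma + 1 != 0 by rewrite addr_eq0.
have gamma1 : 1 - gamma != 0 by rewrite subr_eq0 eq_sym.
have delta0 : 2 * gamma - 1 != 0.
  apply: contraNneq gamma_neqV2 => /eqP; rewrite subr_eq0 => /eqP g2.
  by apply/eqP/(mulfI two0); rewrite g2 divff.
split=> [A LA S /finite_seqP[s ->]|k k1].
  (* The extra index takes the default value 0 and ensures at least one generator. *)
  pose g (i : 'I_(size s).+1) := nth 0 s i.
  have [N QN] := nil3_nilpotent (size s).+1 two0.
  (* The bound need not be optimal here; the maximum with 2 provides [1 < n]. *)
  have gN := gspan_nilpotent two0 three0 gamma_neq0 gammaN1 gamma1 delta0 LA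
    (nilpotent_upto_le (leq_maxl N 2) QN) (g := g) (leq_maxr N 2) (ltn0Sn _).
  eexists; apply: nilpotent_upto_sub gN => x Sx.
  apply: (subalgebra_gen_gspan (g := g)) => B [subB gB]; apply: Sx.
  split=> // y /= ys; apply: gB; exists (inord (index y s)) => //.
  by rewrite /g inordK ?nth_index // ltnS index_size.
have [n [Qn min_n]] := nil3_nilpotency_index k two0; exists n; split=> //.
move=> A [g gA] LA; have [n1|n1] := ltnP 1 n; last first.
  by move=> t _ _; exact: (low_index_trivial two0 three0 gamma_neq0 gammaN1
    delta0 LA Qn n1 gA).
apply: nilpotent_upto_sub (gspan_nilpotent two0 three0 gamma_neq0
  gammaN1 gamma1 delta0 LA Qn (g := g) n1 k1).
by rewrite -gA; apply: subalgebra_gen_gspan.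
Qed.
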